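(* Let $d\ge 1$ and let $\mathrm{B}:\mathbb{C}^{d\times d}\to\mathbb{R}$ be the function $$\mathrm{B}(A)=\|\mathrm{diag}(AA^*-A^*A)\|^2=\sum_{i=1}^d\left(\|A_i\|^2-\|A^i\|^2\right)^2 .$$ The only critical points of $\mathrm{B}$ are its global minima; that is, a matrix $A\in\mathbb{C}^{d\times d}$ is a critical point of $\mathrm{B}$ if and only if $A$ is balanced.
   Context: $A_i$ and $A^i$ denote the $i$th row and the $i$th column of $A$, with $\|A_i\|,\|A^i\|$ their Euclidean (Hermitian) norms; $\|\cdot\|$ on matrices is the Frobenius norm, $\|B\|^2=\sum_{i,j}|b_{ij}|^2$. $\mathrm{diag}:\mathbb{C}^{d\times d}\to\mathbb{C}^{d\times d}$ is the linear map that sets all off-diagonal entries to zero. $A$ is called balanced if $\mathrm{B}(A)=0$, i.e. $\|A_i\|=\|A^i\|$ for all $i$. A critical point of $\mathrm{B}$ is a point where its real derivative vanishes, $\mathbb{C}^{d\times d}$ being viewed as a real vector space. *)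

(* Defs.v *)
From mathcomp Require Import all_boot all_order all_algebra.
From mathcomp Require Import all_classical all_reals all_analysis.
From mathcomp Require Export complex.

Set Implicit Arguments.
Unset Strict Implicit.
Unset Printing Implicit Defensive.

Import Order.TTheory GRing.Theory Num.Theory.
Import numFieldNormedType.Exports.

Local Open Scope ring_scope.
Local Open Scope complex_scope.

Section Imbalance.
Variable R : realType.

(* [`|z|] lives in [R[i]] and has zero imaginary part. *)
Definition frobenius_norm (m n : nat) (M : 'M[R[i]]_(m, n)) : R :=
  Num.sqrt (\sum_(i < m) \sum_(j < n) complex.Re `|M i j| ^+ 2).

Definition diag_part (d : nat) (M : 'M[R[i]]_d) : 'M[R[i]]_d :=
  \matrix_(i, j) (if i == j then M i j else 0).

Definition adjmx (m n : nat) (M : 'M[R[i]]_(m, n)) : 'M[R[i]]_(n, m) :=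
  (map_mx Num.conj M)^T.

Definition imbalance (d : nat) (A : 'M[R[i]]_d) : R :=
  frobenius_norm (diag_part (A *m adjmx A - adjmx A *m A)) ^+ 2.

Definition balanced (d : nat) (A : 'M[R[i]]_d) : Prop := imbalance A = 0.

(* ['M[R[i]]_d] carries no [normedModType R] structure in the library; the
   real vector space underlying it is presented as ['M[R]_d * 'M[R]_d] through
   the R-linear bijection [complexmx : (X, Y) |-> X + i Y], with inverse
   [realmx_pair]. *)
Definition complexmx (d : nat) (P : 'M[R]_d * 'M[R]_d) : 'M[R[i]]_d :=
  \matrix_(i, j) (P.1 i j +i* P.2 i j).

Definition realmx_pair (d : nat) (A : 'M[R[i]]_d) : 'M[R]_d * 'M[R]_d :=
  (map_mx (@complex.Re R) A, map_mx (@complex.Im R) A).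

Lemma complexmxK (d : nat) : cancel (@complexmx d) (@realmx_pair d).
Proof. by case=> X Y; congr (_, _); apply/matrixP => i j; rewrite !mxE. Qed.

Lemma realmx_pairK (d : nat) : cancel (@realmx_pair d) (@complexmx d).
Proof. by move=> A; apply/matrixP => i j; rewrite !mxE; case: (A i j). Qed.

(* Differentiability is required explicitly because ['d g x] is a total
   operator, with an unspecified value where [g] is not differentiable. *)
Definition critical_point (d : nat) (f : 'M[R[i]]_d -> R) (A : 'M[R[i]]_d) :
    Prop :=
  differentiable (f \o @complexmx d) (realmx_pair A) /\
  'd (f \o @complexmx d) (realmx_pair A) = (fun=> 0) :> (_ -> R).

Definition global_min (T : Type) (f : T -> R) (x : T) : Prop :=
  forall y : T, f x <= f y.

End Imbalance.

(* Main.v *)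
(* The map B is a nonnegative real polynomial, homogeneous of degree 4, which
   vanishes at 0; its global minima are therefore exactly its zeros. At a
   critical point A, Euler's identity [dB(A)(A) = 4 B(A)] gives [B(A) = 0].
   Conversely the differential vanishes at any global minimum. *)
Require Import Defs.
From mathcomp Require Import all_boot all_order all_algebra.
From mathcomp Require Import all_classical all_reals all_analysis.
From mathcomp Require Import complex.

Import Order.TTheory GRing.Theory Num.Theory.
Import numFieldNormedType.Exports.

Local Open Scope ring_scope.
Local Open Scope complex_scope.

(** Euler's identity: differentiate [t |-> f (t *: x)] at [t = 1] twice, once by the chain rule and
    once as the monomial [f x * t ^+ n.+1]. *)
Lemma diff_homogeneous (R : realType) (V : normedModType R) (f : V -> R)
    (n : nat) (x : V) :
  (forall t y, f (t *: y) = t ^+ n.+1 * f y) -> differentiable f x ->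
  'd f x x = n.+1%:R * f x.
Proof.
move=> fh dfx.
have fE : f \o ( *:%R ^~ x) = f x *: (idfun : R -> R) ^+ n.+1.
  by apply/funext => t; rewrite !fctE /= fh mulrC.
have [ds dsE] := is_diff_scalel (1 : R) x.
have [_ dpE] := is_diffZ (f x) (is_diffX n (is_diff_id (1 : R))).
(* The chain rule is applied at [1], where [1 *: x = x]; evaluating both differentials at the
   increment [1] gives the two sides. *)
have := diff_comp ds; rewrite scale1r => /(_ _ _ dfx).
rewrite fE dpE dsE => /(congr1 (@^~ 1)).
rewrite !fctE /= scale1r expr1n mulr1 => <-.
by rewrite /GRing.scale /= mulr1 mulrC.
Qed.

(** Difference quotients with positive step are nonnegative at a minimum, so the differential is
    nonnegative in every direction; by linearity, comparing [v] with [- v] forces it to vanish. *)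
Lemma diff_global_min (R : realType) (V : normedModType R) (f : V -> R)
    (x v : V) : global_min f x -> differentiable f x -> 'd f x v = 0.
Proof.
move=> minx dfx.
have d_ge0 w : 0 <= 'd f x w.
  have /cvg_ex [/= L fL] := @diff_derivable _ _ _ f x w dfx.
  rewrite -deriveE // /derive (cvg_lim _ fL) //.
  (* The two-sided limit is restricted to [h > 0], where the factor [h^-1] keeps the sign of the
     increment. *)
  have fL' := cvg_dnbhs_at_right fL.
  rewrite -(cvg_lim _ fL') //; apply: limr_ge; first by apply/cvg_ex; exists L.
  near=> h; apply: mulr_ge0; first by rewrite invr_ge0 ltW.
  by rewrite subr_ge0 /=; exact: minx.
apply/eqP; rewrite eq_le d_ge0 andbT -oppr_ge0 -linearN; exact: d_ge0.
Unshelve. all: by end_near. Qed.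

Section Imbalance.
Context {R : realType}.

Lemma sqr_Re_normc (z : R[i]) :
  complex.Re `|z| ^+ 2 = complex.Re z ^+ 2 + complex.Im z ^+ 2.
Proof. by rewrite normc_def /= sqr_sqrtr ?addr_ge0 ?sqr_ge0. Qed.

Lemma sqr_frobenius_norm (m n : nat) (M : 'M[R[i]]_(m, n)) :
  frobenius_norm M ^+ 2 = \sum_i \sum_j complex.Re `|M i j| ^+ 2.
Proof.
by rewrite sqr_sqrtr //; do 2![apply: sumr_ge0 => ? _]; exact: sqr_ge0.
Qed.

Lemma mulmx_adjmx_diag (m n : nat) (M : 'M[R[i]]_(m, n)) (i : 'I_m) :
  (M *m adjmx M) i i = (frobenius_norm (row i M) ^+ 2)%:C.
Proof.
rewrite sqr_frobenius_norm big_ord1 !mxE rmorph_sum /=.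
by apply: eq_bigr => j _; rewrite !mxE sqr_Re_normc add_Re2_Im2 normCK.
Qed.

Lemma adjmx_mulmx_diag (m n : nat) (M : 'M[R[i]]_(m, n)) (j : 'I_n) :
  (adjmx M *m M) j j = (frobenius_norm (col j M) ^+ 2)%:C.
Proof.
rewrite sqr_frobenius_norm !mxE rmorph_sum /=.
apply: eq_bigr => i _; rewrite big_ord1 !mxE sqr_Re_normc add_Re2_Im2.
by rewrite mulrC normCK.
Qed.

Lemma imbalanceE (d : nat) (A : 'M[R[i]]_d) :
  imbalance A = \sum_(i < d)
    (frobenius_norm (row i A) ^+ 2 - frobenius_norm (col i A) ^+ 2) ^+ 2.
Proof.
rewrite /imbalance sqr_frobenius_norm; apply: eq_bigr => i _.
(* Row [i] of a diagonal part contributes only its entry [j = i], which is real, so its squared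
   modulus is its square. *)
rewrite (bigD1 i) // big1 ?addr0 => [|j ji]; last first.
  by rewrite mxE eq_sym (negbTE ji) normr0 expr0n.
rewrite mxE eqxx mxE mulmx_adjmx_diag mxE adjmx_mulmx_diag -rmorphB.
by rewrite sqr_Re_normc /= expr0n !addr0.
Qed.

(** This explicit polynomial in the real coordinates serves to prove both homogeneity and
    differentiability. *)
Lemma imbalance_complexmxE (d : nat) (P : 'M[R]_d * 'M[R]_d) :
  imbalance (complexmx P) = \sum_(i < d)
    (\sum_(j < d) (P.1 i j ^+ 2 + P.2 i j ^+ 2)
     - \sum_(j < d) (P.1 j i ^+ 2 + P.2 j i ^+ 2)) ^+ 2.
Proof.
rewrite imbalanceE; apply: eq_bigr => i _.
rewrite !sqr_frobenius_norm big_ord1; congr ((_ - _) ^+ 2).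
  by apply: eq_bigr => j _; rewrite sqr_Re_normc !mxE.
by apply: eq_bigr => j _; rewrite big_ord1 sqr_Re_normc !mxE.
Qed.

Lemma imbalance_homogeneous (d : nat) (t : R) (P : 'M[R]_d * 'M[R]_d) :
  imbalance (complexmx (t *: P)) = t ^+ 4 * imbalance (complexmx P).
Proof.
(* Each squared norm scales by [t ^+ 2]; squaring their difference then produces [t ^+ 4]. *)
have sumZ (F G : 'I_d -> R) : \sum_j ((t * F j) ^+ 2 + (t * G j) ^+ 2) =
    t ^+ 2 * \sum_j (F j ^+ 2 + G j ^+ 2).
  by rewrite mulr_sumr; apply: eq_bigr => j _; rewrite mulrDr !exprMn.
rewrite !imbalance_complexmxE mulr_sumr; apply: eq_bigr => i _.
under eq_bigr do rewrite !mxE.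
under [in X in _ - X]eq_bigr do rewrite !mxE.
by rewrite !sumZ -mulrBr exprMn -exprM.
Qed.

Lemma differentiable_imbalance (d : nat) (P : 'M[R]_d * 'M[R]_d) :
  differentiable (@imbalance R d \o @complexmx R d) P.
Proof.
pose re (i j : 'I_d) (Q : 'M[R]_d * 'M[R]_d) := Q.1 i j.
pose im (i j : 'I_d) (Q : 'M[R]_d * 'M[R]_d) := Q.2 i j.
pose sq i j := re i j ^+ 2 + im i j ^+ 2.
have dre i j : differentiable (re i j) P.
  apply: (@differentiable_comp _ _ _ _ fst (fun M : 'M[R]_d => M i j)).
    (* A linear map is differentiable once it is continuous, which is what [cvg_fst] supplies. *)
    by apply: linear_differentiable => Q; exact: cvg_fst.
  exact: differentiable_coord.
have dim i j : differentiable (im i j) P.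
  apply: (@differentiable_comp _ _ _ _ snd (fun M : 'M[R]_d => M i j)).
    by apply: linear_differentiable => Q; exact: cvg_snd.
  exact: differentiable_coord.
have dsq i j : differentiable (sq i j) P.
  by apply: differentiableD; apply: differentiableX.
(* The polynomial is recast as sums and powers of functions, the form to which the differentiation
   rules apply. *)
have -> : @imbalance R d \o @complexmx R d =
    \sum_i (\sum_j sq i j - \sum_j sq j i) ^+ 2.
  apply/funext => Q; rewrite /= imbalance_complexmxE fct_sumE.
  by apply: eq_bigr => i _; rewrite !fctE !fct_sumE.
apply: differentiable_sum => i; apply: differentiableX.
by apply: differentiableB; apply: differentiable_sum => j; exact: dsq.
Qed.

Lemma imbalance_ge0 (d : nat) (A : 'M[R[i]]_d) : 0 <= imbalance A.
Proof. exact: sqr_ge0. Qed.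

Lemma global_min_imbalance (d : nat) (A : 'M[R[i]]_d) :
  global_min (@imbalance R d) A <-> balanced A.
Proof.
split=> [minA|A0 B]; last by rewrite A0 imbalance_ge0.
apply/eqP; rewrite eq_le imbalance_ge0 andbT.
(* Scaling by [0] exhibits a point of value [0], to which the minimum is compared. *)
have := imbalance_homogeneous d 0 (realmx_pair A).
rewrite expr0n mul0r => <-; exact: minA.
Qed.

Lemma critical_point_imbalance (d : nat) (A : 'M[R[i]]_d) :
  critical_point (@imbalance R d) A <-> balanced A.
Proof.
have dB := differentiable_imbalance d (realmx_pair A).
split=> [[_ d0]|A0].
  (* Here [3] encodes the degree [3.+1 = 4]; the zero differential leaves [4 * imbalance A = 0], and
     [4] is nonzero in [R]. *)
  have := diff_homogeneous _ _ (@imbalance R d \o @complexmx R d) 3 _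
    (imbalance_homogeneous d) dB.
  rewrite d0 /= realmx_pairK => /esym/eqP.
  by rewrite mulf_eq0 pnatr_eq0 => /eqP.
have minA : global_min (@imbalance R d \o @complexmx R d) (realmx_pair A).
  by move=> P; rewrite /= realmx_pairK; exact: (global_min_imbalance d A).2.
by split; [|apply/funext => v; rewrite (diff_global_min _ _ _ _ v minA dB)].
Qed.

End Imbalance.

Theorem theorem4p1 (R : realType) (d : nat) (hd : (1 <= d)%N) :
  (forall A : 'M[R[i]]_d,
     imbalance A =
     \sum_(i < d)
        (frobenius_norm (row i A) ^+ 2 - frobenius_norm (col i A) ^+ 2) ^+ 2)
  /\ (forall A : 'M[R[i]]_d,
        critical_point (@imbalance R d) A <-> global_min (@imbalance R d) A)
  /\ (forall A : 'M[R[i]]_d,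
        critical_point (@imbalance R d) A <-> balanced A).
Proof.
split; first exact: imbalanceE.
split=> A; last exact: critical_point_imbalance.
by rewrite critical_point_imbalance global_min_imbalance.
Qed.
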